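(* If $0<x<1$ then $$\sqrt{1+3x}\;F\Big(\frac14,\frac34;1;x^2\Big)=F\Big(\frac14,\frac34;1;1-\Big(\frac{1-x}{1+3x}\Big)^2\Big).$$
   Context: $F={}_2F_1$ denotes the Gauss hypergeometric function, $F(a,b;c;z)=\sum_{n\ge0}\frac{(a)_n(b)_n}{(c)_n\,n!}z^n$ for $|z|<1$. *)

(* Defs.v *)
From Stdlib Require Import Reals Factorial.
From Coquelicot Require Import Coquelicot.
Open Scope R_scope.

(* The rising factorial (a)_n = a (a + 1) ... (a + n - 1), with (a)_0 = 1. *)
Fixpoint pochhammer (a : R) (n : nat) : R :=
  match n with
  | O => 1
  | S m => pochhammer a m * (a + INR m)
  end.

(* [PSeries] is total: its value is the sum of the series where that series
   converges, in particular for |z| < 1, and is only meaningful there.  As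
   usual, c must not be 0 or a negative integer. *)
Definition hyp2F1 (a b c z : R) : R :=
  PSeries
    (fun n : nat =>
       pochhammer a n * pochhammer b n / (pochhammer c n * INR (fact n))) z.

(* Main.v *)
Require Import Defs.
From Stdlib Require Import Reals Factorial Lra.
From Coquelicot Require Import Coquelicot.
Open Scope R_scope.

(** With [f z = F(1/4,3/4;1;z)], put [G x = sqrt (1+3x) f(x^2)] and
    [H x = f(w x)], where [w x = 1 - ((1-x)/(1+3x))^2 = 8x(1+x)/(1+3x)^2].
    The hypergeometric equation with parameters [a + b = c = 1] has the
    self-adjoint form [(z(1-z) f')' = a b f].  Changing variables through
    [z = w x] and through [z = x^2] with the gauge factor [sqrt (1+3x)], both
    [H] and [G] turn out to solve one and the same equation [(P y')' = q y],
    where [P x = x(1-x^2)/(1+3x)] and [q x = (3/2)(1-x)/(1+3x)^3]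
    ([quadratic_side_solves], [rational_side_solves]).

    The point [0] is singular for this equation: [P 0 = 0].  Hence the
    weighted Wronskian [P (H' G - G' H)], which is constant for any two
    solutions, vanishes identically when both are differentiable at [0], so
    that [H / G] is constant ([singular_solution_unique]).  As [G 0 = H 0 = 1]
    and [G] is positive, [G = H] for all [0 <= x < 1]. *)

(** * The series F(a,b;1;z) with a + b = 1 *)

Definition hyp_coef (a b : R) (n : nat) : R :=
  pochhammer a n * pochhammer b n / (pochhammer 1 n * INR (fact n)).

Lemma pochhammer_1 (n : nat) : pochhammer 1 n = INR (fact n).
Proof.
  induction n as [|n IH]; [reflexivity|].
  change (pochhammer 1 (S n)) with (pochhammer 1 n * (1 + INR n)).
  rewrite IH, fact_simpl, mult_INR, S_INR; ring.
Qed.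

Lemma hyp_coef_0 (a b : R) : hyp_coef a b 0 = 1.
Proof. unfold hyp_coef; simpl; field. Qed.

Lemma hyp_coef_S (a b : R) (n : nat) :
  (INR n + 1) ^ 2 * hyp_coef a b (S n)
  = (a + INR n) * (b + INR n) * hyp_coef a b n.
Proof.
  unfold hyp_coef; rewrite !pochhammer_1, fact_simpl, mult_INR, S_INR.
  change (pochhammer a (S n)) with (pochhammer a n * (a + INR n)).
  change (pochhammer b (S n)) with (pochhammer b n * (b + INR n)).
  assert (Hn := pos_INR n); assert (Hf := INR_fact_neq_0 n).
  field; split; [exact Hf | lra].
Qed.

(** The ratio of consecutive coefficients is
    [(n^2 + n + a b) / (n+1)^2], which lies in [(0,1)]. *)
Lemma hyp_coef_bounds (a b : R) (n : nat) :
  0 < a -> 0 < b -> a + b = 1 -> 0 < hyp_coef a b n <= 1.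
Proof.
  intros Ha Hb Hab; induction n as [|n IH].
  - rewrite hyp_coef_0; lra.
  - assert (Hn := pos_INR n).
    assert (Hd : 0 < (INR n + 1) ^ 2) by (apply pow_lt; lra).
    assert (Hr := hyp_coef_S a b n).
    assert (Hp : 0 < (a + INR n) * (b + INR n)) by
      (apply Rmult_lt_0_compat; lra).
    assert (Hle : (a + INR n) * (b + INR n) <= (INR n + 1) ^ 2) by nra.
    split.
    + apply Rmult_lt_reg_l with (1 := Hd); rewrite Hr, Rmult_0_r.
      apply Rmult_lt_0_compat; lra.
    + apply Rmult_le_reg_l with (1 := Hd); rewrite Hr; nra.
Qed.

Lemma hyp_coef_CV_radius (a b z : R) :
  0 < a -> 0 < b -> a + b = 1 -> Rabs z < 1 ->
  Rbar_lt (Rabs z) (CV_radius (hyp_coef a b)).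
Proof.
  intros Ha Hb Hab Hz.
  apply Rbar_lt_le_trans with (Finite 1); [exact Hz|].
  apply (proj1 (CV_radius_bounded _)); exists 1; intros n.
  rewrite pow1, Rmult_1_r.
  destruct (hyp_coef_bounds a b n Ha Hb Hab); rewrite Rabs_pos_eq; lra.
Qed.

Lemma hyp2F1_0 (a b : R) : hyp2F1 a b 1 0 = 1.
Proof. unfold hyp2F1; rewrite PSeries_0; exact (hyp_coef_0 a b). Qed.

Lemma hyp2F1_pos (a b z : R) :
  0 < a -> 0 < b -> a + b = 1 -> 0 <= z < 1 -> 0 < hyp2F1 a b 1 z.
Proof.
  intros Ha Hb Hab Hz.
  assert (Hex : ex_series (fun n => hyp_coef a b n * z ^ n)).
  { apply ex_pseries_R, CV_radius_inside, hyp_coef_CV_radius; trivial.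
    rewrite Rabs_pos_eq; lra. }
  change (0 < Series (fun n => hyp_coef a b n * z ^ n)).
  rewrite Series_incr_1 by exact Hex.
  rewrite hyp_coef_0; simpl (z ^ 0).
  enough (0 <= Series (fun n => hyp_coef a b (S n) * z ^ S n)) by lra.
  rewrite <- (Rmult_0_l (Series (fun n => hyp_coef a b (S n) * z ^ S n))) at 1.
  rewrite <- Series_scal_l.
  apply Series_le;
    [intros n
    | now apply (ex_series_incr_1 (fun n => hyp_coef a b n * z ^ n))].
  rewrite Rmult_0_l; split; [lra|].
  apply Rmult_le_pos; [apply Rlt_le, hyp_coef_bounds | apply pow_le]; tauto.
Qed.

Definition hyp_deriv (a b z : R) : R := PSeries (PS_derive (hyp_coef a b)) z.

Lemma is_derive_hyp2F1 (a b z : R) :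
  0 < a -> 0 < b -> a + b = 1 -> Rabs z < 1 ->
  is_derive (hyp2F1 a b 1) z (hyp_deriv a b z).
Proof.
  intros; apply (is_derive_PSeries (hyp_coef a b)), hyp_coef_CV_radius; trivial.
Qed.

(** The self-adjoint form of the hypergeometric equation.  The coefficient of
    [z^n] in the left-hand derivative is
    [(n+1)^2 u_(n+1) - n(n+1) u_n], which the recurrence for [u = hyp_coef a b]
    turns into [((a+n)(b+n) - n(n+1)) u_n = a b u_n]. *)
Lemma is_derive_hyp_flux (a b z : R) :
  0 < a -> 0 < b -> a + b = 1 -> Rabs z < 1 ->
  is_derive (fun t => t * (1 - t) * hyp_deriv a b t) z (a * b * hyp2F1 a b 1 z).
Proof.
  intros Ha Hb Hab Hz.
  set (d := PS_derive (hyp_coef a b)).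
  set (v := PS_minus (PS_incr_1 d) (PS_incr_1 (PS_incr_1 d))).
  assert (Hv : forall n, PS_derive v n = PS_scal (a * b) (hyp_coef a b) n).
  { intros n; assert (Hr := hyp_coef_S a b n).
    destruct n as [|n].
    - change (INR 1 * (INR 1 * hyp_coef a b 1 + - 0) = a * b * hyp_coef a b 0).
      simpl in *; lra.
    - change (INR (S (S n)) * (INR (S (S n)) * hyp_coef a b (S (S n))
                               + - (INR (S n) * hyp_coef a b (S n)))
              = a * b * hyp_coef a b (S n)).
      rewrite (S_INR (S n)).
      replace b with (1 - a) in * by lra.
      ring_simplify in Hr; ring_simplify; lra. }
  assert (Hab0 : a * b <> 0) by
    (apply Rgt_not_eq, Rmult_lt_0_compat; assumption).
  assert (Hrad : forall t, Rabs t < 1 -> Rbar_lt (Rabs t) (CV_radius v)).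
  { intros t Ht; rewrite <- CV_radius_derive, (CV_radius_ext _ _ Hv).
    rewrite CV_radius_scal by exact Hab0.
    now apply hyp_coef_CV_radius. }
  assert (Heq : PSeries (PS_derive v) z = a * b * hyp2F1 a b 1 z).
  { rewrite (PSeries_ext _ _ z Hv); apply PSeries_scal. }
  rewrite <- Heq.
  apply is_derive_ext_loc with (PSeries v);
    [| apply is_derive_PSeries, Hrad, Hz].
  assert (He : 0 < 1 - Rabs z) by lra.
  exists (mkposreal _ He); intros t Ht; change R in t.
  assert (Ht1 : Rabs t < 1).
  { change (Rabs (t - z) < 1 - Rabs z) in Ht.
    assert (Htri := Rabs_triang (t - z) z).
    replace (t - z + z) with t in Htri by ring; lra. }
  assert (Hd : ex_pseries d t).
  { apply CV_radius_inside; unfold d; rewrite CV_radius_derive.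
    now apply hyp_coef_CV_radius. }
  change (PSeries v t = t * (1 - t) * hyp_deriv a b t).
  unfold v; rewrite PSeries_minus.
  - rewrite !PSeries_incr_1; unfold hyp_deriv; fold d; ring.
  - now apply ex_pseries_incr_1.
  - now apply ex_pseries_incr_1, ex_pseries_incr_1.
Qed.

(** * Uniqueness at a singular point *)

(** The weighted Wronskian [B G - A H] has zero derivative and vanishes with
    [P] at [0], so it is zero; dividing by [P] away from [0] gives
    [(H / G)' = 0].  The quasi-derivatives [P G'] and [P H'] enter as
    functions [A] and [B] of their own, which states the second-order equation
    through first derivatives alone. *)
Lemma singular_solution_unique (P q G dG A H dH B : R -> R) (r : R) :
  0 < r ->
  (forall t, 0 <= t <= r -> is_derive G t (dG t)) ->
  (forall t, 0 <= t <= r -> A t = P t * dG t) ->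
  (forall t, 0 <= t <= r -> is_derive A t (q t * G t)) ->
  (forall t, 0 <= t <= r -> is_derive H t (dH t)) ->
  (forall t, 0 <= t <= r -> B t = P t * dH t) ->
  (forall t, 0 <= t <= r -> is_derive B t (q t * H t)) ->
  P 0 = 0 ->
  (forall t, 0 < t <= r -> P t <> 0) ->
  (forall t, 0 <= t <= r -> G t <> 0) ->
  G 0 = H 0 ->
  G r = H r.
Proof.
  intros Hr HG HA HA' HH HB HB' HP0 HP HG0 Hinit.
  assert (HV : forall t, 0 < t <= r -> B t * G t - A t * H t = 0).
  { intros t Ht.
    transitivity (B 0 * G 0 - A 0 * H 0).
    2: rewrite HA, HB, HP0 by lra; ring.
    symmetry.
    apply (eq_is_derive (fun t => B t * G t - A t * H t) 0 t); [|lra].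
    intros s Hs.
    assert (Hs' : 0 <= s <= r) by lra.
    evar_last.
    - apply (is_derive_minus (fun t => B t * G t) (fun t => A t * H t));
        apply (@is_derive_mult R_AbsRing); eauto using Rmult_comm.
    - unfold minus, plus, opp, mult, zero; simpl.
      rewrite (HA s Hs'), (HB s Hs'); ring. }
  assert (HW : forall t, 0 < t <= r -> dH t * G t - dG t * H t = 0).
  { intros t Ht; assert (E := HV t Ht); rewrite HA, HB in E by lra.
    apply Rmult_eq_reg_l with (P t); [|now apply HP].
    rewrite Rmult_0_r, <- E; ring. }
  assert (HQ : forall t, 0 <= t <= r ->
    is_derive (fun t => H t / G t) t ((dH t * G t - dG t * H t) / G t ^ 2)).
  { intros t Ht; evar_last.
    - apply is_derive_div; eauto.
    - simpl; field; auto. }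
  (* MVT_cor2 puts the intermediate point in the open interval, away from 0,
     where P has been cancelled. *)
  destruct (MVT_cor2 (fun t => H t / G t)
              (fun t => (dH t * G t - dG t * H t) / G t ^ 2) 0 r Hr)
    as (c & Heq & Hc).
  { intros t Ht; apply is_derive_Reals, HQ, Ht. }
  rewrite HW in Heq by lra.
  assert (G0 : G 0 <> 0) by (apply HG0; lra).
  assert (Gr : G r <> 0) by (apply HG0; lra).
  rewrite <- Hinit in Heq.
  unfold Rdiv in Heq; rewrite Rinv_r in Heq by exact G0.
  replace (H r) with (H r * / G r * G r) by (field; exact Gr).
  replace (H r * / G r) with 1 by lra; ring.
Qed.

(** * The two sides of the transformation *)

Definition sl_weight (x : R) : R := x * (1 - x ^ 2) / (1 + 3 * x).
Definition sl_potential (x : R) : R := 3 / 2 * (1 - x) / (1 + 3 * x) ^ 3.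

Definition modulus (x : R) : R := 1 - ((1 - x) / (1 + 3 * x)) ^ 2.
Definition modulus_deriv (x : R) : R := 8 * (1 - x) / (1 + 3 * x) ^ 3.

Lemma is_derive_modulus (x : R) :
  0 <= x -> is_derive modulus x (modulus_deriv x).
Proof.
  intros Hx; unfold modulus, modulus_deriv.
  auto_derive; [lra | field; lra].
Qed.

Lemma modulus_bounds (x : R) : 0 <= x < 1 -> Rabs (modulus x) < 1.
Proof.
  intros Hx.
  assert (Hq : 0 < (1 - x) / (1 + 3 * x) <= 1).
  { split; [apply Rdiv_lt_0_compat; lra|].
    apply Rle_div_l; lra. }
  unfold modulus; rewrite Rabs_pos_eq; nra.
Qed.

(** The substitution [z = w(x)], with [w = modulus], turns [(z(1-z) f')' = a b f] into
    [((w(1-w)/w') H')' = a b w' H].  So the quasi-derivative of [H] is the flux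
    [z(1-z) f'(z)] taken at [z = w(x)], and it remains to recognize
    [w(1-w)/w' = sl_weight] and [(3/16) w' = sl_potential]. *)
Lemma rational_side_solves (x : R) :
  0 <= x < 1 ->
  let F' := hyp_deriv (1 / 4) (3 / 4) in
  let flux t := modulus t * (1 - modulus t) * F' (modulus t) in
  let H t := hyp2F1 (1 / 4) (3 / 4) 1 (modulus t) in
  let dH := modulus_deriv x * F' (modulus x) in
  is_derive H x dH /\ flux x = sl_weight x * dH /\
  is_derive flux x (sl_potential x * H x).
Proof.
  intros Hx F' flux H dH.
  assert (Hm := modulus_bounds x Hx).
  assert (Hd := is_derive_modulus x (proj1 Hx)).
  split; [|split].
  - apply (is_derive_comp (hyp2F1 (1 / 4) (3 / 4) 1) modulus); [|exact Hd].
    apply is_derive_hyp2F1; lra.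
  - unfold flux, dH, sl_weight, modulus_deriv, modulus; field; lra.
  - evar_last.
    + apply (is_derive_comp (fun z => z * (1 - z) * F' z) modulus);
        [|exact Hd].
      apply is_derive_hyp_flux; lra.
    + unfold scal; simpl; unfold mult; simpl.
      unfold H, sl_potential, modulus_deriv; field; lra.
Qed.

(** The quasi-derivative of [G = s F(x^2)] splits into a multiple of
    [F(x^2)], from differentiating [s], and a multiple of the flux
    [z(1-z) F'(z)] at [z = x^2].  In its derivative the terms containing [F']
    cancel: this is what the gauge factor [s = sqrt (1+3x)] achieves. *)
Lemma quadratic_side_solves (x : R) :
  0 <= x < 1 ->
  let F := hyp2F1 (1 / 4) (3 / 4) 1 in
  let F' := hyp_deriv (1 / 4) (3 / 4) in
  let s t := sqrt (1 + 3 * t) in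
  let flux t := 3 / 2 * (t * (1 - t ^ 2) / s t ^ 3) * F (t ^ 2)
                + 2 * (t ^ 2 * (1 - t ^ 2) * F' (t ^ 2)) / s t in
  let G t := s t * F (t ^ 2) in
  let dG := 3 / (2 * s x) * F (x ^ 2) + s x * (2 * x * F' (x ^ 2)) in
  is_derive G x dG /\ flux x = sl_weight x * dG /\
  is_derive flux x (sl_potential x * G x).
Proof.
  intros Hx F F' s flux G dG.
  assert (Hs0 : 0 < s x) by (apply sqrt_lt_R0; lra).
  assert (Hs2 : s x * s x = 1 + 3 * x) by (apply sqrt_sqrt; lra).
  assert (Hx2 : Rabs (x ^ 2) < 1) by (rewrite Rabs_pos_eq; nra).
  assert (Hs : is_derive s x (3 / (2 * s x))).
  { unfold s; auto_derive; [lra|]. fold (s x); field; lra. }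
  assert (Hsq : is_derive (fun t => t ^ 2) x (2 * x)) by
    (auto_derive; [trivial|ring]).
  assert (HF : is_derive (fun t => F (t ^ 2)) x (2 * x * F' (x ^ 2))).
  { apply (is_derive_comp F (fun t => t ^ 2)); [|exact Hsq].
    apply is_derive_hyp2F1; lra. }
  assert (HF' : is_derive (fun t => t ^ 2 * (1 - t ^ 2) * F' (t ^ 2)) x
                  (2 * x * (1 / 4 * (3 / 4) * F (x ^ 2)))).
  { apply (is_derive_comp (fun z => z * (1 - z) * F' z) (fun t => t ^ 2));
      [|exact Hsq].
    apply is_derive_hyp_flux; lra. }
  assert (Hc : is_derive (fun t => t * (1 - t ^ 2) / s t ^ 3) x
    (((1 - 3 * x ^ 2) * s x ^ 3
       - x * (1 - x ^ 2) * (3 * s x ^ 2 * (3 / (2 * s x)))) / (s x ^ 3) ^ 2)).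
  { apply (is_derive_div (fun t => t * (1 - t ^ 2)) (fun t => s t ^ 3)).
    - auto_derive; [trivial | ring].
    - evar_last; [apply is_derive_pow, Hs | simpl; ring].
    - apply pow_nonzero; lra. }
  split; [|split].
  - evar_last.
    + apply (@is_derive_mult R_AbsRing s (fun t => F (t ^ 2)));
        eauto using Rmult_comm.
    + reflexivity.
  - unfold flux, dG, sl_weight; rewrite <- Hs2; field; lra.
  - evar_last.
    + apply (is_derive_plus
        (fun t => 3 / 2 * (t * (1 - t ^ 2) / s t ^ 3) * F (t ^ 2))
        (fun t => 2 * (t ^ 2 * (1 - t ^ 2) * F' (t ^ 2)) / s t)).
      * apply (@is_derive_mult R_AbsRing
          (fun t => 3 / 2 * (t * (1 - t ^ 2) / s t ^ 3)) (fun t => F (t ^ 2)));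
          [apply is_derive_scal, Hc | exact HF | exact Rmult_comm].
      * apply is_derive_div; [apply is_derive_scal, HF' | exact Hs | lra].
    + unfold plus, mult; cbn -[pow].
      unfold G, sl_potential; rewrite <- Hs2.
      (* The remaining identity is rational in s, with x = (s^2 - 1) / 3. *)
      generalize (F (x ^ 2)) (F' (x ^ 2)); intros y y'.
      assert (Hx' : x = (s x * s x - 1) / 3) by lra.
      revert Hs0 Hx'; generalize (s x); intros r Hr Hx'; rewrite Hx'.
      field; lra.
Qed.

Theorem theorem8 (x : R) (hx0 : 0 < x) (hx1 : x < 1) :
  sqrt (1 + 3 * x) * hyp2F1 (1 / 4) (3 / 4) 1 (x ^ 2)
  = hyp2F1 (1 / 4) (3 / 4) 1 (1 - ((1 - x) / (1 + 3 * x)) ^ 2).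
Proof.
  assert (Hdom : forall t, 0 <= t <= x -> 0 <= t < 1) by (intros; lra).
  refine (singular_solution_unique sl_weight sl_potential
    (fun t => sqrt (1 + 3 * t) * hyp2F1 (1 / 4) (3 / 4) 1 (t ^ 2)) _ _
    (fun t => hyp2F1 (1 / 4) (3 / 4) 1 (modulus t)) _ _ x hx0
    (fun t Ht => proj1 (quadratic_side_solves t (Hdom t Ht)))
    (fun t Ht => proj1 (proj2 (quadratic_side_solves t (Hdom t Ht))))
    (fun t Ht => proj2 (proj2 (quadratic_side_solves t (Hdom t Ht))))
    (fun t Ht => proj1 (rational_side_solves t (Hdom t Ht)))
    (fun t Ht => proj1 (proj2 (rational_side_solves t (Hdom t Ht))))
    (fun t Ht => proj2 (proj2 (rational_side_solves t (Hdom t Ht))))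
    _ _ _ _).
  - unfold sl_weight; field.
  - intros t Ht; unfold sl_weight.
    apply Rgt_not_eq, Rdiv_lt_0_compat; [apply Rmult_lt_0_compat|]; nra.
  - intros t Ht; apply Rgt_not_eq, Rmult_lt_0_compat.
    + apply sqrt_lt_R0; lra.
    + apply hyp2F1_pos; nra.
  - unfold modulus.
    replace (0 ^ 2) with 0 by ring.
    replace (1 - ((1 - 0) / (1 + 3 * 0)) ^ 2) with 0 by field.
    rewrite Rmult_0_r, Rplus_0_r, sqrt_1; ring.
Qed.
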